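(* (i) For the Liouville-\c{T}i\c{t}eica PDE $\omega_{uv}=e^{\omega}$, with Lagrangian $L_1=-\frac12\omega_u\omega_v-e^{\omega}$ and variational symmetries $W_1=u\frac{\partial}{\partial u}-\frac{\partial}{\partial\omega}$, $W_2=v\frac{\partial}{\partial v}-\frac{\partial}{\partial\omega}$, $W_3=\frac{\partial}{\partial u}$, $W_4=\frac{\partial}{\partial v}$, the associated flows $P^1$ and conserved densities $P^2$ of the conservation laws corresponding to the vector fields $-W_i$ are: - for $-W_1$: $P^1=\frac12\omega_v-ue^{\omega}$, $P^2=\frac12\omega_u(1+u\omega_u)$; - for $-W_2$: $P^1=\frac12\omega_v(1+v\omega_v)$, $P^2=\frac12\omega_u-ve^{\omega}$; - for $-W_3$: $P^1=-e^{\omega}$, $P^2=\frac12\omega_u^2$; - for $-W_4$: $P^1=\frac12\omega_v^2$, $P^2=-e^{\omega}$. (ii) For the \c{T}i\c{t}eica PDE $\omega_{uv}=e^{\omega}-e^{-2\omega}$, with Lagrangian $L_2=-\frac12\omega_u\omega_v-e^{\omega}-\frac12e^{-2\omega}$ and variational symmetries $U_1=u\frac{\partial}{\partial u}-v\frac{\partial}{\partial v}$, $U_2=\frac{\partial}{\partial u}$, $U_3=\frac{\partial}{\partial v}$, the associated flows and conserved densities of the conservation laws corresponding to the vector fields $-U_i$ are: - for $-U_1$: $P^1=-\frac12ue^{-2\omega}-\frac12v\omega_v^2-ue^{\omega}$, $P^2=\frac12u\omega_u^2+ve^{\omega}+\frac12ve^{-2\omega}$; - for $-U_2$: $P^1=-e^{\omega}-\frac12e^{-2\omega}$,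 $P^2=\frac12\omega_u^2$; - for $-U_3$: $P^1=\frac12\omega_v^2$, $P^2=-e^{\omega}-\frac12e^{-2\omega}$.
   Context: A conservation law of a PDE $\Delta(u,v,\omega^{(2)})=0$ is a divergence expression $\mathrm{Div}\,P=D_uP^1+D_vP^2$ (with $D_u,D_v$ total derivatives) vanishing on all solutions; $P^1$ is called the associated flow and $P^2$ the conserved density. Its characteristic is the function $Q$ with $\mathrm{Div}\,P=Q\cdot\Delta$. The characteristic of a vector field $X=\zeta\frac{\partial}{\partial u}+\eta\frac{\partial}{\partial v}+\phi\frac{\partial}{\partial\omega}$ is $Q=\phi-\zeta\omega_u-\eta\omega_v$. If $X$ is a variational symmetry of $\int\!\!\int L(u,v,\omega,\omega_u,\omega_v)\,du\,dv$, its characteristic $Q$ is also the characteristic of a conservation law of the Euler-Lagrange equation $E(L)=\frac{\partial L}{\partial\omega}-D_u\frac{\partial L}{\partial\omega_u}-D_v\frac{\partial L}{\partial\omega_v}=0$ (so $\Delta=E(L)$); the corresponding $P=(P^1,P^2)$ is given by $P^1=-\left(Q\frac{\partial L}{\partial\omega_u}+L\zeta\right)$, $P^2=-\left(Q\frac{\partial L}{\partial\omega_v}+L\eta\right)$. *)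

(* Defs.v *)
From Stdlib Require Import Reals.
From Coquelicot Require Import Coquelicot.

Open Scope R_scope.

(** Differential functions of two independent variables [u], [v] and one
    dependent variable [w], as functions on the jet spaces of order 0, 1, 2.
    The jet coordinates come in the order
    [u v w], then [wu wv], then [wuu wuv wvv]. *)
Definition dfun0 := R -> R -> R -> R.
Definition dfun1 := R -> R -> R -> R -> R -> R.
Definition dfun2 := R -> R -> R -> R -> R -> R -> R -> R -> R.

(** [Derive] is defined (with a junk value) on every function, so the partial
    and total derivatives below are meaningful for smooth differential
    functions only. *)
Definition Du0 (F : dfun0) : dfun1 := fun u v w wu wv =>
  Derive (fun t => F t v w) u + wu * Derive (fun t => F u v t) w.

Definition Dv0 (F : dfun0) : dfun1 := fun u v w wu wv =>
  Derive (fun t => F u t w) v + wv * Derive (fun t => F u v t) w.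

Definition d_w (F : dfun1) : dfun1 := fun u v w wu wv =>
  Derive (fun t => F u v t wu wv) w.
Definition d_wu (F : dfun1) : dfun1 := fun u v w wu wv =>
  Derive (fun t => F u v w t wv) wu.
Definition d_wv (F : dfun1) : dfun1 := fun u v w wu wv =>
  Derive (fun t => F u v w wu t) wv.

(** Total derivatives; the order goes up by one. *)
Definition Du (F : dfun1) : dfun2 := fun u v w wu wv wuu wuv wvv =>
  Derive (fun t => F t v w wu wv) u + wu * d_w F u v w wu wv
  + wuu * d_wu F u v w wu wv + wuv * d_wv F u v w wu wv.

Definition Dv (F : dfun1) : dfun2 := fun u v w wu wv wuu wuv wvv =>
  Derive (fun t => F u t w wu wv) v + wv * d_w F u v w wu wv
  + wuv * d_wu F u v w wu wv + wvv * d_wv F u v w wu wv.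

Definition Div (P1 P2 : dfun1) : dfun2 := fun u v w wu wv wuu wuv wvv =>
  Du P1 u v w wu wv wuu wuv wvv + Dv P2 u v w wu wv wuu wuv wvv.

Definition euler_lagrange (L : dfun1) : dfun2 :=
  fun u v w wu wv wuu wuv wvv =>
  d_w L u v w wu wv - Du (d_wu L) u v w wu wv wuu wuv wvv
                    - Dv (d_wv L) u v w wu wv wuu wuv wvv.

Definition along (F : dfun2) (f : R -> R -> R) (u v : R) : R :=
  F u v (f u v)
    (partial_derive 1 0 f u v) (partial_derive 0 1 f u v)
    (partial_derive 2 0 f u v) (partial_derive 1 1 f u v)
    (partial_derive 0 2 f u v).

(** Classical ([C^2]) solutions of [Delta = 0] on [D]. *)
Definition is_solution (Delta : dfun2) (D : R * R -> Prop) (f : R -> R -> R) :=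
  forall u v, D (u, v) -> ex_diff_n f 2 u v /\ along Delta f u v = 0.

Definition conservation_law (Delta : dfun2) (P1 P2 : dfun1) : Prop :=
  forall (D : R * R -> Prop) (f : R -> R -> R),
    open D -> is_solution Delta D f ->
    forall u v, D (u, v) -> along (Div P1 P2) f u v = 0.

Definition has_characteristic (Delta : dfun2) (P1 P2 Q : dfun1) : Prop :=
  forall u v w wu wv wuu wuv wvv,
    Div P1 P2 u v w wu wv wuu wuv wvv
    = Q u v w wu wv * Delta u v w wu wv wuu wuv wvv.

(** The vector field [zeta d/du + eta d/dv + phi d/dw]. *)
Record vfield := VField { zeta : dfun0; eta : dfun0; phi : dfun0 }.

Definition vf_opp (X : vfield) : vfield :=
  VField (fun u v w => - zeta X u v w)
         (fun u v w => - eta X u v w)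
         (fun u v w => - phi X u v w).

Definition vf_char (X : vfield) : dfun1 := fun u v w wu wv =>
  phi X u v w - zeta X u v w * wu - eta X u v w * wv.

(** Coefficients of [d/dwu] and [d/dwv] in the first prolongation of [X]. *)
Definition prol_u (X : vfield) : dfun1 := fun u v w wu wv =>
  Du0 (phi X) u v w wu wv - wu * Du0 (zeta X) u v w wu wv
                          - wv * Du0 (eta X) u v w wu wv.
Definition prol_v (X : vfield) : dfun1 := fun u v w wu wv =>
  Dv0 (phi X) u v w wu wv - wu * Dv0 (zeta X) u v w wu wv
                          - wv * Dv0 (eta X) u v w wu wv.

Definition pr1 (X : vfield) (F : dfun1) : dfun1 := fun u v w wu wv =>
  zeta X u v w * Derive (fun t => F t v w wu wv) u
  + eta X u v w * Derive (fun t => F u t w wu wv) v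
  + phi X u v w * d_w F u v w wu wv
  + prol_u X u v w wu wv * d_wu F u v w wu wv
  + prol_v X u v w wu wv * d_wv F u v w wu wv.

(** [X] leaves the action [L du dv] invariant:
    [pr X (L) + L (D_u zeta + D_v eta) = 0], with no divergence term on the
    right, which is the case covered by [noether_flow] and
    [noether_density]. *)
Definition variational_symmetry (L : dfun1) (X : vfield) : Prop :=
  forall u v w wu wv,
    pr1 X L u v w wu wv
    + L u v w wu wv * (Du0 (zeta X) u v w wu wv + Dv0 (eta X) u v w wu wv) = 0.

Definition noether_flow (L : dfun1) (X : vfield) : dfun1 :=
  fun u v w wu wv =>
  - (vf_char X u v w wu wv * d_wu L u v w wu wv
     + L u v w wu wv * zeta X u v w).

Definition noether_density (L : dfun1) (X : vfield) : dfun1 :=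
  fun u v w wu wv =>
  - (vf_char X u v w wu wv * d_wv L u v w wu wv
     + L u v w wu wv * eta X u v w).

(** [(P1, P2)] is the flow and density of the conservation law of
    [Delta = 0] corresponding to [X], where [Delta] is the Euler-Lagrange
    expression of [L]. *)
Record corresponding_law (Delta : dfun2) (L : dfun1) (X : vfield)
    (P1 P2 : dfun1) : Prop := CorrespondingLaw {
  law_flow : forall u v w wu wv,
    noether_flow L X u v w wu wv = P1 u v w wu wv;
  law_density : forall u v w wu wv,
    noether_density L X u v w wu wv = P2 u v w wu wv;
  law_char : has_characteristic Delta P1 P2 (vf_char X);
  law_conservation : conservation_law Delta P1 P2
}.

Definition is_lagrangian (L : dfun1) (Delta : dfun2) : Prop :=
  forall u v w wu wv wuu wuv wvv,
    euler_lagrange L u v w wu wv wuu wuv wvv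
    = Delta u v w wu wv wuu wuv wvv.

Definition liouville_tzitzeica : dfun2 := fun u v w wu wv wuu wuv wvv =>
  wuv - exp w.
Definition tzitzeica : dfun2 := fun u v w wu wv wuu wuv wvv =>
  wuv - (exp w - exp (- 2 * w)).

Definition L1 : dfun1 := fun u v w wu wv =>
  - (1 / 2) * wu * wv - exp w.
Definition L2 : dfun1 := fun u v w wu wv =>
  - (1 / 2) * wu * wv - exp w - 1 / 2 * exp (- 2 * w).

Definition W1 := VField (fun u v w => u) (fun u v w => 0) (fun u v w => -1).
Definition W2 := VField (fun u v w => 0) (fun u v w => v) (fun u v w => -1).
Definition W3 := VField (fun u v w => 1) (fun u v w => 0) (fun u v w => 0).
Definition W4 := VField (fun u v w => 0) (fun u v w => 1) (fun u v w => 0).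

Definition U1 := VField (fun u v w => u) (fun u v w => - v) (fun u v w => 0).
Definition U2 := VField (fun u v w => 1) (fun u v w => 0) (fun u v w => 0).
Definition U3 := VField (fun u v w => 0) (fun u v w => 1) (fun u v w => 0).

(* Main.v *)
Require Import Defs.
From Stdlib Require Import Reals FunctionalExtensionality.
From Coquelicot Require Import Coquelicot.

Open Scope R_scope.

(** Noether's identity writes [Div P] as [Q] times the Euler-Lagrange expression, so [Div P]
    vanishes on solutions ([characteristic_conservation_law]). As every field and Lagrangian is
    explicit, general Noether theory is bypassed: after differentiation each claim is an algebraic
    identity in the jet coordinates, [exp w] and [exp (- 2 * w)]. *)

Lemma characteristic_conservation_law (Delta : dfun2) (P1 P2 Q : dfun1) :
  has_characteristic Delta P1 P2 Q -> conservation_law Delta P1 P2.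
Proof.
intros HQ D f _ Hf u v Huv.
destruct (Hf u v Huv) as [_ H0].
unfold along in *.
now rewrite HQ, H0, Rmult_0_r.
Qed.

Lemma corresponding_law_of_characteristic (Delta : dfun2) (L : dfun1)
    (X : vfield) (P1 P2 : dfun1) :
  (forall u v w wu wv, noether_flow L X u v w wu wv = P1 u v w wu wv) ->
  (forall u v w wu wv, noether_density L X u v w wu wv = P2 u v w wu wv) ->
  has_characteristic Delta P1 P2 (vf_char X) ->
  corresponding_law Delta L X P1 P2.
Proof.
intros H1 H2 HQ.
split; trivial.
exact (characteristic_conservation_law _ _ _ _ HQ).
Qed.

(* The evar [l] is instantiated by the [reflexivity] that closes [auto_derive]. *)
Ltac eval_derive :=
  repeat match goal with
  | |- context [Derive ?f ?x] =>
      let l := fresh "l" in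
      evar (l : R);
      replace (Derive f x) with l
        by (symmetry; apply is_derive_unique; unfold l;
            auto_derive; [exact I | reflexivity]);
      unfold l; clear l
  end.

(** This and the next five are equalities of functions because [Du (d_wu L)] takes [d_wu L]
    unapplied; rewriting there avoids nested [Derive]. *)
Lemma d_w_L1 : d_w L1 = fun u v w wu wv => - exp w.
Proof.
do 5 (apply functional_extensionality; intro).
unfold d_w, L1; eval_derive; field.
Qed.

Lemma d_wu_L1 : d_wu L1 = fun u v w wu wv => - (1 / 2) * wv.
Proof.
do 5 (apply functional_extensionality; intro).
unfold d_wu, L1; eval_derive; field.
Qed.

Lemma d_wv_L1 : d_wv L1 = fun u v w wu wv => - (1 / 2) * wu.
Proof.
do 5 (apply functional_extensionality; intro).
unfold d_wv, L1; eval_derive; field.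
Qed.

Lemma d_w_L2 : d_w L2 = fun u v w wu wv => - exp w + exp (- 2 * w).
Proof.
do 5 (apply functional_extensionality; intro).
unfold d_w, L2; eval_derive; field.
Qed.

Lemma d_wu_L2 : d_wu L2 = fun u v w wu wv => - (1 / 2) * wv.
Proof.
do 5 (apply functional_extensionality; intro).
unfold d_wu, L2; eval_derive; field.
Qed.

Lemma d_wv_L2 : d_wv L2 = fun u v w wu wv => - (1 / 2) * wu.
Proof.
do 5 (apply functional_extensionality; intro).
unfold d_wv, L2; eval_derive; field.
Qed.

(** The kinetic term contributes [wuv / 2] through each total derivative, so the Euler-Lagrange
    expression is [wuv] plus the derivative of the potential. *)
Ltac solve_lagrangian :=
  intros u v w wu wv wuu wuv wvv; unfold euler_lagrange;
  rewrite ?d_w_L1, ?d_wu_L1, ?d_wv_L1, ?d_w_L2, ?d_wu_L2, ?d_wv_L2;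
  unfold Du, Dv, d_w, d_wu, d_wv, liouville_tzitzeica, tzitzeica;
  eval_derive; field.

(** Translations work as [L1], [L2] do not involve [u], [v]. For [W1] and [W2] the shift of [w]
    makes [exp w] scale like [wu * wv], which offsets the scaling of the area. [U1] preserves area,
    [wu * wv] and [w], hence also the term [exp (- 2 * w)]. *)
Ltac solve_symmetry :=
  intros u v w wu wv; unfold pr1;
  rewrite ?d_w_L1, ?d_wu_L1, ?d_wv_L1, ?d_w_L2, ?d_wu_L2, ?d_wv_L2;
  unfold prol_u, prol_v, Du0, Dv0, L1, L2; simpl;
  eval_derive; field.

Ltac solve_law :=
  apply corresponding_law_of_characteristic;
  [ intros u v w wu wv; unfold noether_flow;
    rewrite ?d_wu_L1, ?d_wu_L2; unfold vf_char, L1, L2; simpl; field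
  | intros u v w wu wv; unfold noether_density;
    rewrite ?d_wv_L1, ?d_wv_L2; unfold vf_char, L1, L2; simpl; field
  (* The identity is checked at every jet, with [wuv] free rather than replaced through the
     equation. *)
  | intros u v w wu wv wuu wuv wvv;
    unfold Div, Du, Dv, d_w, d_wu, d_wv, vf_char,
      liouville_tzitzeica, tzitzeica; simpl;
    eval_derive; field ].

Theorem proposition3 :
  (is_lagrangian L1 liouville_tzitzeica
   /\ (variational_symmetry L1 W1 /\ variational_symmetry L1 W2
       /\ variational_symmetry L1 W3 /\ variational_symmetry L1 W4)
   /\ corresponding_law liouville_tzitzeica L1 (vf_opp W1)
        (fun u v w wu wv => 1 / 2 * wv - u * exp w)
        (fun u v w wu wv => 1 / 2 * wu * (1 + u * wu))
   /\ corresponding_law liouville_tzitzeica L1 (vf_opp W2)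
        (fun u v w wu wv => 1 / 2 * wv * (1 + v * wv))
        (fun u v w wu wv => 1 / 2 * wu - v * exp w)
   /\ corresponding_law liouville_tzitzeica L1 (vf_opp W3)
        (fun u v w wu wv => - exp w)
        (fun u v w wu wv => 1 / 2 * wu ^ 2)
   /\ corresponding_law liouville_tzitzeica L1 (vf_opp W4)
        (fun u v w wu wv => 1 / 2 * wv ^ 2)
        (fun u v w wu wv => - exp w))
  /\
  (is_lagrangian L2 tzitzeica
   /\ (variational_symmetry L2 U1 /\ variational_symmetry L2 U2
       /\ variational_symmetry L2 U3)
   /\ corresponding_law tzitzeica L2 (vf_opp U1)
        (fun u v w wu wv =>
           - (1 / 2) * u * exp (- 2 * w) - 1 / 2 * v * wv ^ 2 - u * exp w)
        (fun u v w wu wv =>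
           1 / 2 * u * wu ^ 2 + v * exp w + 1 / 2 * v * exp (- 2 * w))
   /\ corresponding_law tzitzeica L2 (vf_opp U2)
        (fun u v w wu wv => - exp w - 1 / 2 * exp (- 2 * w))
        (fun u v w wu wv => 1 / 2 * wu ^ 2)
   /\ corresponding_law tzitzeica L2 (vf_opp U3)
        (fun u v w wu wv => 1 / 2 * wv ^ 2)
        (fun u v w wu wv => - exp w - 1 / 2 * exp (- 2 * w))).
Proof.
split; (split; [solve_lagrangian | split; [repeat split; solve_symmetry |]]).
- split; [solve_law |]; split; [solve_law |]; split; solve_law.
- split; [solve_law |]; split; solve_law.
Qed.
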